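(* Let $S$ be a measurable space. For $1\le n\le\infty$, let $P_n$ be a transition kernel on $S$ with a unique stationary distribution $\pi_n$. Suppose that for each $x\in S$: (i) $P_n(x,\cdot)\overset{\mathrm{tv}}{\to}P_\infty(x,\cdot)$ as $n\to\infty$; (ii) $P_{\infty,x}(X_m\in\cdot)\overset{\mathrm{tv}}{\to}\pi_\infty(\cdot)$ as $m\to\infty$; (iii) $\pi_n\overset{\mathrm{tv}}{\to}\pi_\infty$ as $n\to\infty$. Then, for each $x\in S$, $$\sup_{m\ge 0}\| P_{n,x}(X_m\in\cdot)-P_{\infty,x}(X_m\in\cdot)\|_{e}\to 0\quad\text{as } n\to\infty.$$
   Context: The index $n$ ranges over $\{1,2,\dots\}\cup\{\infty\}$. For $x\in S$, $P_{n,x}$ is the probability on path space $S^\infty$ under which the coordinate process $X=(X_m:m\ge 0)$ is a Markov chain with $X_0=x$ and one-step transition kernel $P_n$. A stationary distribution of $P_n$ is a probability $\pi_n$ with $\int_S\pi_n(dy)P_n(y,\cdot)=\pi_n(\cdot)$. For a finite signed measure $\nu$ on $S$, $\|\nu\|_e=\sup\left|\int_S f\,d\nu\right|$, the supremum being over all measurable $f:S\to\mathbb{R}$ with $|f(x)|\le 1$ for all $x\in S$ (the total variation norm). For probabilities, $\eta_n\overset{\mathrm{tv}}{\to}\eta_\infty$ means $\|\eta_n-\eta_\infty\|_e\to 0$. *)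

(* Defs.v *)
From HB Require Import structures.
From mathcomp Require Import all_boot all_order all_algebra.
From mathcomp Require Import all_classical all_reals all_analysis.
From mathcomp Require Import lra.

Set Implicit Arguments.
Unset Strict Implicit.
Unset Printing Implicit Defensive.

Import Order.TTheory GRing.Theory Num.Theory.
Import numFieldNormedType.Exports.

Local Open Scope classical_set_scope.
Local Open Scope ring_scope.
Local Open Scope ereal_scope.

Fact fin_num_subDE (R : realType) (j n m e : \bar R) :
  j \is a fin_num -> n \is a fin_num -> m \is a fin_num -> e \is a fin_num ->
  (m - e = j - n <-> j + e = n + m).
Proof.
move: j n m e => [a||] [b||] [c||] [e||]//= _ _ _ _.
by rewrite -?EFinB -?EFinD; split=> -[h]; congr (EFin _); lra.
Qed.

Section signed_measures.
Context d (T : measurableType d) (R : realType).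
Implicit Types (nu : {charge set T -> \bar R}) (mu eta : probability T R).

Definition hahn_pos nu : set T := projT1 (cid (Hahn_decomposition nu)).

Definition hahn_neg nu : set T :=
  projT1 (cid (projT2 (cid (Hahn_decomposition nu)))).

Lemma hahn_posneg nu : hahn_decomposition nu (hahn_pos nu) (hahn_neg nu).
Proof. exact: projT2 (cid (projT2 (cid (Hahn_decomposition nu)))). Qed.

(* The value does not depend on the Hahn decomposition that was chosen, since
   two of them give the same Jordan measures (Hahn_decomposition_uniq). It is
   the intended one when f is bounded. *)
Definition charge_integral nu (f : T -> R) : \bar R :=
  \int[jordan_pos (hahn_posneg nu)]_x (f x)%:E
  - \int[jordan_neg (hahn_posneg nu)]_x (f x)%:E.

(* The supremum is over all f bounded by 1, so that for a difference of two
   probabilities this is twice the supremum over events. *)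
Definition e_norm nu : \bar R :=
  ereal_sup [set `|charge_integral nu f| | f in
    [set f : T -> R | measurable_fun setT f /\ forall x, (`|f x| <= 1)%R]].

Definition prob_diff mu eta : {charge set T -> \bar R} :=
  cadd (charge_of_finite_measure mu) (copp (charge_of_finite_measure eta)).

Lemma charge_integral_prob_diff mu eta (f : T -> R) :
  measurable_fun setT f -> (exists M, forall x, (`|f x| <= M)%R) ->
  charge_integral (prob_diff mu eta) f =
  \int[mu]_x (f x)%:E - \int[eta]_x (f x)%:E.
Proof.
move=> mf [M fM]; rewrite /charge_integral.
set jp := jordan_pos _; set jn := jordan_neg _.
have ints (m : {finite_measure set T -> \bar R}) :
    m.-integrable setT (EFin \o f).
  apply: measurable_bounded_integrable => //.
    by rewrite -ge0_fin_numE// fin_num_measure.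
  exists M; split; first exact: num_real.
  by move=> x Mx y _; exact: (le_trans (fM y) (ltW Mx)).
have E : \int[jp]_x (f x)%:E + \int[eta]_x (f x)%:E
       = \int[jn]_x (f x)%:E + \int[mu]_x (f x)%:E.
  have H1 := @integral_measure_add _ T R jp eta setT measurableT _
    (ints jp) (ints eta).
  have H2 := @integral_measure_add _ T R jn mu setT measurableT _
    (ints jn) (ints mu).
  rewrite -[LHS]H1 -[RHS]H2; apply: eq_measure_integral => A mA _.
  rewrite [LHS]measure_addE [RHS]measure_addE.
  have fj : jp A \is a fin_num by rewrite fin_num_measure.
  have fjn : jn A \is a fin_num by rewrite fin_num_measure.
  have fm : mu A \is a fin_num by rewrite fin_num_measure.
  have fe : eta A \is a fin_num by rewrite fin_num_measure.
  have K : mu A - eta A = jp A - jn A.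
    have := jordan_decomp (hahn_posneg (prob_diff mu eta)) mA.
    rewrite -/jp -/jn => H; rewrite [LHS](_ : _ = prob_diff mu eta A)// H.
    by rewrite -[cadd _ _ A]/(jp A + cscale (-1) jn A) /cscale mulN1e.
  exact: (proj1 (fin_num_subDE fj fjn fm fe) K).
have F (m : {finite_measure set T -> \bar R}) : \int[m]_x (f x)%:E \is a fin_num.
  exact: integrable_fin_num (ints m).
exact: esym (proj2 (fin_num_subDE (F jp) (F jn) (F mu) (F eta)) E).
Qed.

Definition tv_cvg (eta_ : nat -> probability T R) (eta : probability T R) :=
  e_norm (prob_diff (eta_ n) eta) @[n --> \oo] --> 0.

End signed_measures.

Section transition_kernels.
Context d (S : measurableType d) (R : realType).

(* k x, which the library only equips with a measure structure, as a
   probability. *)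
Definition kernel_prob (k : R.-pker S ~> S) (x : S) : set S -> \bar R := k x.

HB.instance Definition _ k x := Measure.on (kernel_prob k x).

HB.instance Definition _ k x :=
  Measure_isProbability.Build _ _ _ (kernel_prob k x) (prob_kernel x).

Definition stationary (k : R.-pker S ~> S) (mu : probability S R) :=
  forall A, measurable A -> \int[mu]_y k y A = mu A.

(* Library measures are functions on all subsets of S, and only their values
   on measurable sets are meaningful. *)
Definition unique_stationary (k : R.-pker S ~> S) (mu : probability S R) :=
  stationary k mu /\
  forall mu' : probability S R, stationary k mu' ->
    forall A, measurable A -> mu' A = mu A.

End transition_kernels.

Section path_spaces.
Context d (S : measurableType d).

(* events determined by a coordinate X_k with k satisfying K *)
Definition coord_events (K : set nat) : set (set (nat -> S)) :=
  [set (fun w => w k) @^-1` B | k in K & B in measurable].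

(* S^oo with the product sigma-algebra. *)
Definition path_space : measurableType _ := g_sigma_algebraType (coord_events setT).

Definition coordinate (m : nat) : path_space -> S := fun w => w m.

Lemma measurable_coordinate m : measurable_fun setT (coordinate m).
Proof.
move=> _ B mB; rewrite setTI; apply: sub_sigma_algebra.
by exists m => //; exists B.
Qed.

HB.instance Definition _ m :=
  isMeasurableFun.Build _ _ _ _ (coordinate m) (measurable_coordinate m).

Definition past (m : nat) : set (set path_space) :=
  <<s coord_events [set k | (k <= m)%N] >>.

End path_spaces.
Arguments path_space {d} S.

Section markov_chains.
Context d (S : measurableType d) (R : realType).

(* The first clause is X_0 = x, read as "X_0 has law \d_x", as {x} need not be
   measurable. The second clause says that k (X_m) B is a version of the
   conditional probability of X_{m+1} \in B given X_0, ..., X_m. *)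
Definition markov_chain_from (k : R.-pker S ~> S) (x : S)
    (Q : probability (path_space S) R) :=
  (forall B, measurable B -> Q (coordinate 0 @^-1` B) = \d_x B) /\
  (forall m E B, past m E -> measurable B ->
    Q (E `&` coordinate m.+1 @^-1` B) = \int[Q]_(w in E) k (coordinate m w) B).

Definition law (Q : probability (path_space S) R) (m : nat) : probability S R :=
  distribution Q (coordinate m).

End markov_chains.

(* Main.v *)
(* A transition kernel is a contraction for the total variation norm, so the
   distance from the law of X_m to a stationary distribution is nonincreasing
   in m. Hence for m >= M both laws of X_m are controlled at the single time M:
   P_{n,x}(X_m in .) is no farther from pi_n than P_{n,x}(X_M in .), which is
   close to P_{infty,x}(X_M in .), hence to pi_infty and to pi_n. At each fixed
   time the laws converge by induction on the time, using dominated convergence.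
   Only the finitely many times m <= M are then needed. *)
Require Import Defs.
From mathcomp Require Import all_boot all_order all_algebra.
From mathcomp Require Import all_classical all_reals all_analysis.
From mathcomp Require Import measurable_realfun giry lra.

Set Implicit Arguments.
Unset Strict Implicit.
Unset Printing Implicit Defensive.

Import Order.TTheory GRing.Theory Num.Theory.
Import numFieldNormedType.Exports.

Local Open Scope classical_set_scope.
Local Open Scope ring_scope.
Local Open Scope ereal_scope.

(** An eventual bound by 1 already forces finite values, which reduces a limit in [\bar R] to one in
    [R]. *)
Lemma ge0_cvge0P (R : realType) (u : nat -> \bar R) : (forall n, 0 <= u n) ->
  u n @[n --> \oo] --> 0 <->
  forall e : R, (0 < e)%R -> \forall n \near \oo, u n <= e%:E.
Proof.
move=> u0; split=> [/fine_cvgP[ufin /cvgr0Pnorm_le u_cvg] e e0|u_le].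
  near=> n.
  have un : u n \is a fin_num by near: n.
  rewrite -(fineK un) lee_fin (le_trans (ler_norm _))//.
  by near: n; exact: u_cvg.
have ufin : \forall n \near \oo, u n \is a fin_num.
  apply: filterS (u_le 1%R ltr01) => n un.
  by rewrite ge0_fin_numE// (le_lt_trans un) ?ltry.
apply/fine_cvgP; split=> //; apply/cvgr0Pnorm_le => e e0.
near=> n.
have un : u n \is a fin_num by near: n.
rewrite /= ger0_norm ?fine_ge0// -lee_fin fineK//.
by near: n; exact: u_le.
Unshelve. all: by end_near. Qed.

(** * Total variation distance through real integrals of test functions *)

Section total_variation.
Context d (T : measurableType d) (R : realType).
Implicit Types (mu eta : probability T R) (f g : T -> R) (e : R).

Definition test_fun f := measurable_fun setT f /\ forall x, (`|f x| <= 1)%R.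

(** This is [e_norm (prob_diff mu eta) <= e%:E] expressed by real integrals, so that triangle
    inequalities are computed in [R]. *)
Definition tv_le mu eta e := forall f, test_fun f ->
  (`|Rintegral mu setT f - Rintegral eta setT f| <= e)%R.

Lemma integrable_bounded mu f (M : R) : measurable_fun setT f ->
  (forall x, (`|f x| <= M)%R) -> mu.-integrable setT (EFin \o f).
Proof.
move=> mf fM; apply: measurable_bounded_integrable => //.
  by rewrite -ge0_fin_numE// fin_num_measure.
exists M; split; first exact: num_real.
by move=> x Mx y _; exact: le_trans (fM y) (ltW Mx).
Qed.

Lemma integrable_test mu f : test_fun f -> mu.-integrable setT (EFin \o f).
Proof. by case=> mf; exact: integrable_bounded. Qed.

Lemma EFin_Rintegral mu f : test_fun f ->
  \int[mu]_x (f x)%:E = (Rintegral mu setT f)%:E.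
Proof.
move=> tf; rewrite /Rintegral fineK//.
exact: integrable_fin_num (integrable_test mu tf).
Qed.

(** The shift by 1 gives access to integration formulas for nonnegative functions. *)
Lemma test_fun_add1 f : test_fun f ->
  (forall x, 0 <= f x + 1)%R /\ measurable_fun setT (fun x => (f x + 1)%:E).
Proof.
move=> [mf f1]; split=> [x|].
  by move: (f1 x); rewrite ler_norml => /andP[]; lra.
by apply/measurable_EFinP; exact: measurable_funD.
Qed.

Lemma EFin_Rintegral_add1 mu f : test_fun f ->
  \int[mu]_x (f x + 1)%:E = (Rintegral mu setT f + 1)%:E.
Proof.
move=> tf; under eq_integral do rewrite EFinD.
rewrite integralD//; last 2 first.
- exact: integrable_test.
- exact: finite_measure_integrable_cst.
rewrite EFin_Rintegral// integral_cst// mul1e EFinD; congr adde.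
exact: probability_setT.
Qed.

Lemma test_fun0 : test_fun (cst 0%R).
Proof. by split=> // x; rewrite normr0. Qed.

Lemma Rintegral_cst_probability mu (c : R) : Rintegral mu setT (cst c) = c.
Proof.
rewrite Rintegral_cst// -[RHS]mulr1; congr (_ * _)%R.
by rewrite -[RHS]/(fine 1); congr fine; exact: probability_setT.
Qed.

Lemma le_norm_Rintegral mu f (M : R) : measurable_fun setT f ->
  (forall x, (`|f x| <= M)%R) -> (`|Rintegral mu setT f| <= M)%R.
Proof.
move=> mf fM; have fi := integrable_bounded mu mf fM.
apply: (le_trans (le_normr_Rintegral measurableT fi)).
have <- : Rintegral mu setT (cst M) = M.
  exact: Rintegral_cst_probability.
apply: le_Rintegral => //; first exact: (integrable_norm fi).
exact: finite_measure_integrable_cst.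
Qed.

Lemma charge_integral_test mu eta f : test_fun f ->
  charge_integral (prob_diff mu eta) f =
  (Rintegral mu setT f - Rintegral eta setT f)%:E.
Proof.
move=> tf; rewrite charge_integral_prob_diff; last 2 first.
- exact: tf.1.
- by exists 1%R; exact: tf.2.
by rewrite !EFin_Rintegral.
Qed.

Lemma e_norm_le mu eta e :
  e_norm (prob_diff mu eta) <= e%:E <-> tv_le mu eta e.
Proof.
split=> [le_e f tf|le_e].
  rewrite -lee_fin (le_trans _ le_e)//; apply: ereal_sup_ubound.
  by exists f => //; rewrite charge_integral_test.
apply: ge_ereal_sup => _ [f tf <-].
by rewrite charge_integral_test// lee_fin; exact: le_e.
Qed.

Lemma e_norm_ge0 mu eta : 0 <= e_norm (prob_diff mu eta).
Proof.
apply: le_trans (ereal_sup_ubound _); last first.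
  by exists (cst 0%R); first exact: test_fun0.
exact: abse_ge0.
Qed.

Lemma tv_cvgP (eta_ : nat -> probability T R) eta :
  tv_cvg eta_ eta <->
  forall e, (0 < e)%R -> \forall n \near \oo, tv_le (eta_ n) eta e.
Proof.
rewrite /tv_cvg ge0_cvge0P; last by move=> n; exact: e_norm_ge0.
by split=> H e /H; apply: filterS => n /e_norm_le.
Qed.

Lemma tv_leC mu eta e : tv_le mu eta e -> tv_le eta mu e.
Proof. by move=> H f /H; rewrite distrC. Qed.

Lemma tv_leD mu nu eta (e1 e2 : R) :
  tv_le mu nu e1 -> tv_le nu eta e2 -> tv_le mu eta (e1 + e2).
Proof.
move=> H1 H2 f tf; rewrite -(subrKA (Rintegral nu setT f)).
by apply: le_trans (ler_normD _ _) _; apply: lerD; [exact: H1|exact: H2].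
Qed.

End total_variation.

(** * Action of a kernel on probabilities and, dually, on functions *)

Section kernels.
Context d (S : measurableType d) (R : realType).
Implicit Types (k : R.-pker S ~> S) (mu nu eta : probability S R).

(** As a relation, it covers both consecutive laws of a chain and a stationary distribution paired
    with itself. *)
Definition kernel_image k mu nu :=
  forall B, measurable B -> nu B = \int[mu]_y k y B.

Definition dual k (f : S -> R) (y : S) : R :=
  Rintegral (kernel_prob k y) setT f.

(** Seen as a measurable map into the space of probabilities, [k] is an arrow for the Giry monad,
    and [nu] agrees on measurable sets with the bind of [mu] along it. *)
Lemma ge0_integral_kernel_image k mu nu (f : S -> \bar R) :
  kernel_image k mu nu ->
  measurable_fun [set: S] f -> (forall x, 0 <= f x) ->
  \int[nu]_x f x = \int[mu]_y \int[kernel_prob k y]_x f x.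
Proof.
move=> knu mf f0.
pose kp (y : S) : giry S R := kernel_prob k y.
have mkp : measurable_fun setT kp.
  by apply: measurable_giry_codensity => // B mB; exact: measurable_kernel.
rewrite -[RHS](giry_int_bind mu mkp mf f0).
apply: eq_measure_integral => B mB _; apply: etrans (knu B mB) _.
by rewrite [RHS]giry_int_map//; exact: measurable_giry_ev.
Qed.

Lemma test_fun_dual k f : test_fun f -> test_fun (dual k f).
Proof.
move=> tf; split; last first.
  by move=> y; apply: le_norm_Rintegral; [exact: tf.1|exact: tf.2].
have [f1_ge0 mf1] := test_fun_add1 tf.
(* Measurability of a kernel integral is available for nonnegative integrands, hence [f + 1]; each
   [k y] has mass 1, so subtracting 1 recovers [dual k f]. *)
rewrite (_ : dual k f =
    fun y => (fine (\int[kernel_prob k y]_x (f x + 1)%:E) - 1)%R); last first.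
  by apply/funext => y; rewrite EFin_Rintegral_add1//= addrK.
apply: measurable_funB => //; apply: measurableT_comp => //.
apply: measurable_fun_integral_kernel => //.
by move=> U mU; exact: measurable_kernel.
Qed.

Lemma Rintegral_kernel_image k mu nu f : kernel_image k mu nu -> test_fun f ->
  Rintegral nu setT f = Rintegral mu setT (dual k f).
Proof.
move=> knu tf; have tkf := test_fun_dual k tf.
have [f1_ge0 mf1] := test_fun_add1 tf.
have := ge0_integral_kernel_image knu mf1 f1_ge0.
rewrite EFin_Rintegral_add1//.
under eq_integral do rewrite EFin_Rintegral_add1//.
by rewrite -/(dual k f) EFin_Rintegral_add1// => -[] /addIr.
Qed.

(** Contraction: by duality, testing the images against [f] is testing [mu] and [mu'] against
    [dual k f], again a test function. *)
Lemma tv_le_kernel_image k mu nu mu' nu' e :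
  kernel_image k mu nu -> kernel_image k mu' nu' ->
  tv_le mu mu' e -> tv_le nu nu' e.
Proof.
move=> knu knu' le_e f tf.
by rewrite (Rintegral_kernel_image knu)// (Rintegral_kernel_image knu')//;
  exact/le_e/test_fun_dual.
Qed.

(** Total variation is uniform over test functions, so [f_ n] may vary with [n]: the integrand still
    tends to 0 at each [y], and it is dominated by 2. *)
Lemma dual_cvg (k_ : nat -> R.-pker S ~> S) k mu (f_ : nat -> S -> R) :
  (forall y, tv_cvg (fun n => kernel_prob (k_ n) y) (kernel_prob k y)) ->
  (forall n, test_fun (f_ n)) ->
  (Rintegral mu setT (dual (k_ n) (f_ n)) - Rintegral mu setT (dual k (f_ n)))%R
    @[n --> \oo] --> (0 : R)%R.
Proof.
move=> k_k tf.
pose g n y := (dual (k_ n) (f_ n) y - dual k (f_ n) y)%R.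
have tk n := test_fun_dual k (tf n).
have tkn n := test_fun_dual (k_ n) (tf n).
have mg n : measurable_fun setT (g n).
  by apply: measurable_funB; [exact: (tkn n).1|exact: (tk n).1].
have g2 n y : (`|g n y| <= 2)%R.
  apply: le_trans (ler_normB _ _) _.
  by have := (tk n).2 y; have := (tkn n).2 y; lra.
have [] := @dominated_convergence _ S R mu setT measurableT
  (fun n y => (g n y)%:E) (cst 0) (cst 2%:E).
- by move=> n; exact/measurable_EFinP.
- by [].
- apply: aeW => y _; apply/fine_cvgP; split; first exact: nearW.
  apply/cvgr0Pnorm_le => e e0.
  move/tv_cvgP : (k_k y) => /(_ e e0); apply: filterS => n.
  exact.
- exact: finite_measure_integrable_cst.
- by apply: aeW => y n _; rewrite lee_fin.
move=> _ _; rewrite integral0 => /fine_cvg; apply: cvg_trans.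
apply: near_eq_cvg; apply: nearW => n /=.
rewrite -RintegralB//.
- exact: integrable_test (tkn n).
- exact: integrable_test (tk n).
Qed.

(* The total variation distance between k_ n y and k y need not be measurable
   in y, so dominated convergence is applied to a sequence of test functions
   witnessing the failure. *)
Lemma tv_cvg_kernel_image (k_ : nat -> R.-pker S ~> S) k
    (mu_ nu_ : nat -> probability S R) mu nu :
  (forall y, tv_cvg (fun n => kernel_prob (k_ n) y) (kernel_prob k y)) ->
  (\forall n \near \oo, kernel_image (k_ n) (mu_ n) (nu_ n)) ->
  kernel_image k mu nu -> tv_cvg mu_ mu -> tv_cvg nu_ nu.
Proof.
move=> k_k kn_nu k_nu /tv_cvgP mu_mu; apply/tv_cvgP => e e0.
have e2 : (0 < e / 2)%R by rewrite divr_gt0.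
pose D n f :=
  (`|Rintegral mu setT (dual (k_ n) f) - Rintegral mu setT (dual k f)|)%R.
(* [f_ n] is a test function violating the bound [e / 2] if there is one, and 0 otherwise; the bound
   at [f_ n] alone thus gives it for all test functions. *)
have /choice[f_ f_P] n : exists f, test_fun f /\
    (D n f <= e / 2 -> forall g, test_fun g -> D n g <= e / 2)%R.
  have [[f [tf Df]]|nf] := pselect (exists f, test_fun f /\ (e / 2 < D n f)%R).
    by exists f; split=> //; rewrite leNgt Df.
  exists (cst 0%R); split; first exact: test_fun0.
  by move=> _ g tg; rewrite leNgt; apply/negP => Dg; apply: nf; exists g.
have := dual_cvg mu k_k (fun n => (f_P n).1).
move=> /cvgr0Pnorm_le/(_ _ e2) Df.
near=> n => f tf.
have kn : kernel_image (k_ n) (mu_ n) (nu_ n) by near: n.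
rewrite (Rintegral_kernel_image kn)// (Rintegral_kernel_image k_nu)//.
(* The intermediate term separates the change of measure, from [mu_ n] to [mu], from the change of
   kernel, from [k_ n] to [k]. *)
rewrite -(subrKA (Rintegral mu setT (dual (k_ n) f))) (splitr e).
apply: le_trans (ler_normD _ _) _; apply: lerD.
  have : tv_le (mu_ n) mu (e / 2) by near: n; exact: mu_mu.
  by apply; exact: test_fun_dual.
by apply: (f_P n).2 => //; near: n.
Unshelve. all: by end_near. Qed.

(** * Laws of a Markov chain at successive times *)

Lemma kernel_image_law k x (Q : probability (path_space S) R) m :
  markov_chain_from k x Q -> kernel_image k (law Q m) (law Q m.+1).
Proof.
move=> [_ markov] B mB.
rewrite ge0_integral_distribution//; last exact: measurable_kernel.
(* The Markov property is applied to the sure event, which lies in the past as the preimage of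
   [setT] under X_0. *)
have mT : past (S := S) m setT.
  apply: sub_sigma_algebra; exists 0%N => //.
  by exists setT; rewrite ?preimage_setT.
by have := markov m setT B mT mB; rewrite setTI.
Qed.

Lemma tv_le_law0 k k' x (Q Q' : probability (path_space S) R) :
  markov_chain_from k x Q -> markov_chain_from k' x Q' ->
  tv_le (law Q 0) (law Q' 0) 0.
Proof.
move=> [Q0 _] [Q'0 _] f _; rewrite normr_le0 subr_eq0; apply/eqP.
congr fine; apply: eq_measure_integral => B mB _.
by rewrite [LHS]Q0// [RHS]Q'0.
Qed.

(** Stationarity makes [eta] its own image, so each step from [m] to [n] is one use of the
    contraction. *)
Lemma tv_le_law_mono k x (Q : probability (path_space S) R) eta m n e :
  markov_chain_from k x Q -> stationary k eta -> (m <= n)%N ->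
  tv_le (law Q m) eta e -> tv_le (law Q n) eta e.
Proof.
move=> markov st /subnK <- le_e; elim: (n - m)%N => [//|j IH].
rewrite addSn; apply: tv_le_kernel_image (kernel_image_law _ markov) _ IH.
by move=> B mB; rewrite st.
Qed.

(** Induction on [m]: at time 0 all laws are [\d_x], and each step passes through one kernel. *)
Lemma tv_cvg_law (k_ : nat -> R.-pker S ~> S) k x
    (Q_ : nat -> probability (path_space S) R) Q m :
  (forall y, tv_cvg (fun n => kernel_prob (k_ n) y) (kernel_prob k y)) ->
  (\forall n \near \oo, markov_chain_from (k_ n) x (Q_ n)) ->
  markov_chain_from k x Q ->
  tv_cvg (fun n => law (Q_ n) m) (law Q m).
Proof.
move=> k_k Qn_markov Q_markov; elim: m => [|m IH].
  apply/tv_cvgP => e e0; apply: filterS Qn_markov => n Qn f tf.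
  exact: le_trans (tv_le_law0 Qn Q_markov tf) (ltW e0).
apply: tv_cvg_kernel_image k_k _ (kernel_image_law _ Q_markov) IH.
by apply: filterS Qn_markov => n; exact: kernel_image_law.
Qed.

End kernels.

Theorem proposition1 (R : realType) (d : measure_display)
    (S : measurableType d)
    (P : nat -> R.-pker S ~> S) (Pinf : R.-pker S ~> S)
    (pi : nat -> probability S R) (piinf : probability S R)
    (Pr : nat -> S -> probability (path_space S) R)
    (Prinf : S -> probability (path_space S) R)
    (hpi : forall n, (1 <= n)%N -> unique_stationary (P n) (pi n))
    (hpiinf : unique_stationary Pinf piinf)
    (hPr : forall n, (1 <= n)%N ->
      forall x, markov_chain_from (P n) x (Pr n x))
    (hPrinf : forall x, markov_chain_from Pinf x (Prinf x))
    (hi : forall x,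
      tv_cvg (fun n => kernel_prob (P n) x) (kernel_prob Pinf x))
    (hii : forall x, tv_cvg (law (Prinf x)) piinf)
    (hiii : tv_cvg pi piinf) :
  forall x,
    ereal_sup (range (fun m =>
      e_norm (prob_diff (law (Pr n x) m) (law (Prinf x) m))))
    @[n --> \oo] --> 0.
Proof.
move=> x; apply/ge0_cvge0P => [n|e e0].
  apply: le_trans (ereal_sup_ubound _); last by exists 0%N.
  exact: e_norm_ge0.
(* The indices start at 1, so the Markov property holds only eventually in [nat]. *)
have Pr_markov : \forall n \near \oo, markov_chain_from (P n) x (Pr n x).
  by exists 1%N => // n /= n1; exact: hPr.
have law_cvg m := tv_cvg_law m hi Pr_markov (hPrinf x).
(* For late times, three fifths lead from the law of [Pr n x] at time [M] to [pi n], and two lead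
   from [pi n] to the law of [Prinf x] at time [m]. *)
have e5 : (0 < e / 5)%R by rewrite divr_gt0.
have [M _ MP] := (tv_cvgP _ _).1 (hii x) _ e5.
near=> n.
have n1 : (1 <= n)%N by near: n; exists 1%N.
have pin : tv_le (pi n) piinf (e / 5) by near: n; exact: (tv_cvgP _ _).1.
have lawM : tv_le (law (Pr n x) M) (law (Prinf x) M) (e / 5).
  by near: n; exact: (tv_cvgP _ _).1 (law_cvg M) _ e5.
(* Indexing by the finite type ['I_M] lets one threshold on [n] serve all times before [M]. *)
have law_small : forall m : 'I_M,
    tv_le (law (Pr n x) m) (law (Prinf x) m) e.
  near: n; apply: filter_forall => m.
  exact: (tv_cvgP _ _).1 (law_cvg m) _ e0.
apply: ge_ereal_sup => _ [m _ <-]; apply/e_norm_le.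
have [mM|Mm] := ltnP m M; first exact: (law_small (Ordinal mM)).
have -> : e = ((e / 5 + e / 5 + e / 5) + (e / 5 + e / 5))%R by lra.
(* The path goes through the law of [Prinf x] at time [M], then [piinf]. *)
have close_M : tv_le (law (Pr n x) M) (pi n) (e / 5 + e / 5 + e / 5).
  by apply: tv_leD (tv_leC pin); apply: tv_leD lawM (MP _ _) => /=.
(* Moving from time [M] to [m] costs nothing, because the reference [pi n] is stationary for [P n]
   itself. *)
apply: tv_leD (tv_le_law_mono (hPr n n1 x) (hpi n n1).1 Mm close_M) _.
exact: tv_leD pin (tv_leC (MP m Mm)).
Unshelve. all: by end_near. Qed.
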